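(* Let $p$ be a prime and let $\mathbf{c}=(c_n)_{n\ge1}$ be an oscillating sequence of complex numbers satisfying the growth condition $\sum_{n=1}^N|c_n|^\lambda=O(N)$ for some $\lambda>1$. Then $\mathbf{c}$ is linearly disjoint from every $p$-adic polynomial flow $\mathcal{X}=(\mathbb{Z}_p,P)$ with $P\in\mathbb{Z}_p[x]$.
   Context: $\mathbb{Z}_p$ is the ring of $p$-adic integers with the $p$-adic metric; a polynomial $P\in\mathbb{Z}_p[x]$ is regarded as a map $\mathbb{Z}_p\to\mathbb{Z}_p$. A sequence $(c_n)_{n\ge1}$ of complex numbers is oscillating if $\lim_{N\to\infty}\frac1N\sum_{n=1}^N c_n e^{-2\pi i n t}=0$ for every $t\in[0,1)$. For a compact metric space $X$ and a continuous map $T:X\to X$, $(c_n)$ is linearly disjoint from the flow $(X,T)$ if $\lim_{N\to\infty}\frac1N\sum_{n=1}^N c_n f(T^n x)=0$ for every continuous $f:X\to\mathbb{C}$ and every $x\in X$. *)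

(* Defs.v *)
From HB Require Import structures.
From mathcomp Require Import all_boot all_order all_algebra.
From mathcomp Require Import all_classical all_reals all_analysis.
From mathcomp.real_closed Require Import complex.

Set Implicit Arguments.
Unset Strict Implicit.
Unset Printing Implicit Defensive.

Import Order.TTheory GRing.Theory Num.Theory.
Import numFieldNormedType.Exports.

Local Open Scope classical_set_scope.
Local Open Scope ring_scope.

(* Z_p as the inverse limit of the rings Z/p^n: [pres x n] is the representative
   of x modulo p^n in {0, ..., p^n - 1}; the bound is implied by coherence. *)
Record padic_int (p : nat) (p_pr : prime p) := PadicInt {
  pres :> nat -> nat;
  presP : forall n, (pres n.+1 %% p ^ n)%N = pres n }.

Section PadicRing.
Context {p : nat} {p_pr : prime p}.
Local Notation Zp := (padic_int p_pr).
Implicit Types x y z : Zp.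

HB.instance Definition _ := gen_eqMixin Zp.
HB.instance Definition _ := gen_choiceMixin Zp.

Lemma padicP x y : pres x =1 pres y -> x = y.
Proof.
case: x y => [u hu] [v hv] /= /funext uv; move: hu hv; rewrite uv => hu hv.
by congr PadicInt; exact: Prop_irrelevance.
Qed.

Lemma pres_mod x n : (x n %% p ^ n)%N = x n.
Proof. by rewrite -presP modn_mod. Qed.

Lemma pres_lt x n : (x n < p ^ n)%N.
Proof. by rewrite -presP ltn_pmod// expn_gt0 prime_gt0. Qed.

Lemma pres_le x m n : (m <= n)%N -> x m = (x n %% p ^ m)%N.
Proof.
elim: n => [|n IH]; first by rewrite leqn0 => /eqP ->; rewrite pres_mod.
rewrite leq_eqVlt => /predU1P[->|mn]; first by rewrite pres_mod.
by rewrite IH// -presP modn_dvdm// dvdn_exp2l.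
Qed.

Lemma padic_of_subproof (f : nat -> nat) :
    (forall n, f n.+1 = f n %[mod p ^ n]) ->
  forall n, (f n.+1 %% p ^ n.+1 %% p ^ n)%N = (f n %% p ^ n)%N.
Proof. by move=> h n; rewrite modn_dvdm ?dvdn_exp2l. Qed.

Definition padic_of (f : nat -> nat) (h : forall n, f n.+1 = f n %[mod p ^ n]) :
  Zp := @PadicInt p p_pr (fun n => f n %% p ^ n)%N (padic_of_subproof h).

Lemma padic_add_subproof x y n : (x n.+1 + y n.+1 = x n + y n %[mod p ^ n])%N.
Proof. by rewrite -modnDm !presP. Qed.

Lemma padic_mul_subproof x y n : (x n.+1 * y n.+1 = x n * y n %[mod p ^ n])%N.
Proof. by rewrite -modnMm !presP. Qed.

Lemma padic_opp_subproof x n :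
  (p ^ n.+1 - x n.+1 = p ^ n - x n %[mod p ^ n])%N.
Proof.
apply/eqP; rewrite -(eqn_modDr (x n.+1)) subnK ?(ltnW (pres_lt _ _))//.
rewrite expnS modnMl -modnDmr presP subnK ?(ltnW (pres_lt _ _))//.
by rewrite modnn.
Qed.

Definition padic_const (k : nat) : Zp :=
  @padic_of (fun=> k) (fun=> erefl).
Definition padic_add x y : Zp := padic_of (padic_add_subproof x y).
Definition padic_mul x y : Zp := padic_of (padic_mul_subproof x y).
Definition padic_opp x : Zp := padic_of (padic_opp_subproof x).

Lemma padic_addA : associative padic_add.
Proof. by move=> x y z; apply: padicP => n /=; rewrite modnDml modnDmr addnA. Qed.
Lemma padic_addC : commutative padic_add.
Proof. by move=> x y; apply: padicP => n /=; rewrite addnC. Qed.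
Lemma padic_add0 : left_id (padic_const 0) padic_add.
Proof. by move=> x; apply: padicP => n /=; rewrite mod0n add0n pres_mod. Qed.
Lemma padic_addN : left_inverse (padic_const 0) padic_opp padic_add.
Proof.
move=> x; apply: padicP => n /=.
by rewrite modnDml subnK ?(ltnW (pres_lt _ _))// modnn mod0n.
Qed.
HB.instance Definition _ :=
  GRing.isZmodule.Build Zp padic_addA padic_addC padic_add0 padic_addN.

Lemma padic_mulA : associative padic_mul.
Proof. by move=> x y z; apply: padicP => n /=; rewrite modnMml modnMmr mulnA. Qed.
Lemma padic_mulC : commutative padic_mul.
Proof. by move=> x y; apply: padicP => n /=; rewrite mulnC. Qed.
Lemma padic_mul1 : left_id (padic_const 1) padic_mul.
Proof. by move=> x; apply: padicP => n /=; rewrite modnMml mul1n pres_mod. Qed.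
Lemma padic_mulD : left_distributive padic_mul +%R.
Proof.
move=> x y z; apply: padicP => n /=.
by rewrite modnMml modnDml modnDmr mulnDl.
Qed.
Lemma padic_1neq0 : padic_const 1 != 0.
Proof.
apply/eqP => /(congr1 (fun x : Zp => x 1%N)) /=.
by rewrite expn1 mod0n modn_small// prime_gt1.
Qed.
HB.instance Definition _ := GRing.Zmodule_isComNzRing.Build Zp
  padic_mulA padic_mulC padic_mul1 padic_mulD padic_1neq0.

Lemma pres0 n : (0 : Zp) n = 0%N.
Proof. exact: mod0n. Qed.
Lemma presD x y n : (x + y) n = ((x n + y n) %% p ^ n)%N.
Proof. by []. Qed.
Lemma presM x y n : (x * y) n = ((x n * y n) %% p ^ n)%N.
Proof. by []. Qed.
Lemma presN x n : (- x) n = ((p ^ n - x n) %% p ^ n)%N.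
Proof. by []. Qed.

Lemma presB_eq0 x y n : ((x - y) n == 0%N) = (x n == y n).
Proof.
apply/eqP/eqP => [h|h].
  by rewrite -[x](subrK y) presD h add0n pres_mod.
by rewrite presD presN modnDmr h subnKC ?(ltnW (pres_lt _ _))// modnn.
Qed.

Lemma presX_eq (P : {poly Zp}) x y n : x n = y n -> P.[x] n = P.[y] n.
Proof.
move=> xy; elim/poly_ind: P => [|P c IH]; first by rewrite !horner0.
by rewrite !hornerMXaddC !presD !presM IH xy.
Qed.

End PadicRing.

Section PadicMetric.
Context {p : nat} {p_pr : prime p}.
Local Notation Zp := (padic_int p_pr).
Implicit Types x y z : Zp.

(* |x|_p = p^(- v) where v is the least n such that p^(n+1) does not divide x;
   |0|_p = 0. *)
Definition padic_norm (R : realType) x : R :=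
  if pselect (exists n, x n.+1 != 0%N) is left h then p%:R ^- ex_minn h else 0.

Lemma padic_norm_le (R : realType) x n :
  (padic_norm R x <= p%:R ^- n) = (x n == 0%N).
Proof.
have p1 : 1 < p%:R :> R by rewrite ltr1n prime_gt1.
have pn k : 0 < p%:R ^+ k :> R by rewrite exprn_gt0// (lt_trans _ p1).
rewrite /padic_norm; case: pselect => [h|h]; last first.
  rewrite invr_ge0 (ltW (pn _)); apply/esym.
  case: n => [|n]; first by rewrite -[_ == _]/(_ == 0%N) -pres_mod modn1.
  by apply: contrapT => hn; apply: h; exists n; exact/negP.
case: ex_minnP => m hm mmin.
rewrite lef_pV2 ?posrE// ler_eXn2l//.
apply/idP/idP => [nm|/eqP xn].
  case: n nm => [|n] nm; first by rewrite -pres_mod modn1.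
  by rewrite leqNgt in nm; apply: contraNT nm => /mmin; rewrite ltnS.
rewrite leqNgt; apply: contra hm => mn.
by rewrite (pres_le x mn) xn mod0n.
Qed.

Lemma padic_norm_ge0 (R : realType) x : 0 <= padic_norm R x.
Proof.
by rewrite /padic_norm; case: pselect => // h; rewrite invr_ge0 exprn_ge0.
Qed.

Lemma padic_norm_eq0 (R : realType) x : padic_norm R x = 0 -> x = 0.
Proof.
move=> x0; apply: padicP => n; apply/eqP; rewrite pres0 -(padic_norm_le R) x0.
by rewrite invr_ge0 exprn_ge0.
Qed.

Definition padic_dist (R : realType) x y : R := padic_norm R (x - y).

Definition padic_ball (R : realType) x (e : R) : set Zp :=
  [set y | padic_dist R x y < e].

(* the entourages { (x, y) | x = y mod p^n } generate the uniformity of the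
   p-adic metric, see [padic_entE] *)
Definition padic_ent : set_system (Zp * Zp) :=
  filter_from [set: nat] (fun n => [set xy : Zp * Zp | xy.1 n = xy.2 n]).

Lemma padic_ent_filter : Filter padic_ent.
Proof.
apply: filter_from_filter; first by exists 0%N.
move=> i j _ _; exists (maxn i j) => // -[x y] /= xy; split => /=.
  by rewrite !(pres_le _ (leq_maxl i j)) xy.
by rewrite !(pres_le _ (leq_maxr i j)) xy.
Qed.

Local Open Scope relation_scope.

Lemma padic_ent_diag A : padic_ent A -> diagonal `<=` A.
Proof. by move=> [n _ nA] [x y]; rewrite /diagonal /= => <-; exact: nA. Qed.

Lemma padic_ent_inv A : padic_ent A -> padic_ent A^-1.
Proof. by move=> [n _ nA]; exists n => // -[x y] /= xy; exact: nA. Qed.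

Lemma padic_ent_split A :
  padic_ent A -> exists2 B, padic_ent B & B \; B `<=` A.
Proof.
move=> [n _ nA]; exists [set xy : Zp * Zp | xy.1 n = xy.2 n]; first by exists n.
by move=> [x y] /= [z /= xz zy]; apply: nA; rewrite /= xz.
Qed.

HB.instance Definition _ := @isUniform.Build Zp padic_ent
  padic_ent_filter padic_ent_diag padic_ent_inv padic_ent_split.

Section PadicDist.
Context {R : realType}.

Lemma padic_dist_le x y n : (padic_dist R x y <= p%:R ^- n) = (x n == y n).
Proof. by rewrite padic_norm_le presB_eq0. Qed.

Lemma padic_distxx x : padic_dist R x x = 0.
Proof.
rewrite /padic_dist subrr /padic_norm; case: pselect => // h.
by exfalso; case: h => n; rewrite pres0.
Qed.

Lemma padic_dist_ge0 x y : 0 <= padic_dist R x y.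
Proof. exact: padic_norm_ge0. Qed.

Lemma padic_dist_eq0 x y : padic_dist R x y = 0 -> x = y.
Proof. by move/padic_norm_eq0/eqP; rewrite subr_eq0 => /eqP. Qed.

Lemma padic_dist_val x y :
  padic_dist R x y = 0 \/ exists n, padic_dist R x y = p%:R ^- n.
Proof.
rewrite /padic_dist /padic_norm; case: pselect => [h|]; last by left.
by right; eexists.
Qed.

Lemma padic_dist_sym x y : padic_dist R x y = padic_dist R y x.
Proof.
suff H u v : padic_dist R u v <= padic_dist R v u by apply/le_anti; rewrite !H.
have [vu0|[n vu]] := padic_dist_val v u.
  by rewrite (padic_dist_eq0 vu0).
rewrite vu padic_dist_le eq_sym.
by rewrite -padic_dist_le vu.
Qed.

Lemma padic_dist_ultra x y z :
  padic_dist R x z <= Num.max (padic_dist R x y) (padic_dist R y z).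
Proof.
have := padic_dist_val x y; have := padic_dist_val y z.
set M := Num.max _ _ => yz xy.
have : M = 0 \/ exists n, M = p%:R ^- n by rewrite /M; case: leP.
have xyM : padic_dist R x y <= M by rewrite le_max lexx.
have yzM : padic_dist R y z <= M by rewrite le_max lexx orbT.
case=> [M0|[n Mn]].
  suff -> : x = y by [].
  by apply: padic_dist_eq0; apply: le_anti; rewrite -{1}M0 xyM padic_dist_ge0.
move: xyM yzM; rewrite Mn !padic_dist_le => /eqP -> /eqP ->.
exact: eqxx.
Qed.

Lemma padic_dist_triangle y x z :
  padic_dist R x z <= padic_dist R x y + padic_dist R y z.
Proof.
apply: (le_trans (padic_dist_ultra x y z)).
by rewrite ge_max lerDl lerDr !padic_dist_ge0.
Qed.

Lemma padic_ball_center x (e : R) : 0 < e -> padic_ball x e x.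
Proof. by rewrite /padic_ball /= padic_distxx. Qed.

Lemma padic_ball_sym x y (e : R) : padic_ball x e y -> padic_ball y e x.
Proof. by rewrite /padic_ball /= padic_dist_sym. Qed.

Lemma padic_ball_triangle x y z (e1 e2 : R) :
  padic_ball x e1 y -> padic_ball y e2 z -> padic_ball x (e1 + e2) z.
Proof.
rewrite /padic_ball /= => xy yz.
by rewrite (le_lt_trans (padic_dist_triangle y x z))// ltrD.
Qed.

Lemma padic_entE : @entourage Zp = entourage_ (@padic_ball R).
Proof.
have p1 : 1 < p%:R :> R by rewrite ltr1n prime_gt1.
apply/seteqP; split => A.
  move=> [n _ nA]; exists (p%:R ^- n) => /=.
    by rewrite invr_gt0 exprn_gt0// (lt_trans _ p1).
  move=> [x y] /= xy; apply: nA => /=; apply/eqP.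
  by rewrite -padic_dist_le ltW.
move=> [e /= e0 eA].
have [n ne] : exists n, p%:R ^- n < e.
  have /cvgr_lt /(_ _ e0) [n _ /(_ n (leqnn n)) ne] :
      (fun n => (p%:R^-1 : R) ^+ n) @ \oo --> (0 : R).
    by apply: cvg_expr; rewrite ger0_norm// invf_lt1// (lt_trans _ p1).
  by exists n; rewrite -exprVn.
exists n => // -[x y] /= xy; apply: eA => /=.
by apply: le_lt_trans ne; rewrite padic_dist_le xy.
Qed.

End PadicDist.

HB.instance Definition _ (R : realType) := @Uniform_isPseudoMetric.Build R Zp
  (@padic_ball R) padic_ball_center padic_ball_sym padic_ball_triangle
  padic_entE.

HB.instance Definition _ (R : realType) := @PseudoMetric_isMetric.Build R Zp
  (@padic_dist R) padic_dist_ge0 padic_dist_eq0 (fun _ _ => erefl).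

Lemma padic_nbhsP x (A : set Zp) :
  nbhs x A <-> exists n, [set y : Zp | y n = x n] `<=` A.
Proof.
rewrite -nbhs_entourageE; split.
  move=> [B [n _ nB] BA]; exists n => y /= yx.
  by apply: BA; apply/mem_set; apply: nB.
move=> [n nA]; exists [set xy : Zp * Zp | xy.1 n = xy.2 n]; first by exists n.
by move=> y /xsectionP /= xy; apply: nA.
Qed.

Lemma padic_horner_continuous (P : {poly Zp}) : continuous (horner P).
Proof.
move=> x A /padic_nbhsP[n nA]; apply/padic_nbhsP; exists n => y /= yx.
by apply: nA => /=; apply: presX_eq.
Qed.

Lemma padic_compact : compact [set: Zp].
Proof.
rewrite compact_ultra => F UF _.
have FT : F setT by exact: filterT.
have res n : {a | F [set x : Zp | x n = a]}.
  apply: cid.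
  suff H k : F [set x : Zp | (x n < k)%N] -> exists a, F [set x : Zp | x n = a].
    apply: (H (p ^ n)%N); apply: filterS FT => x _ /=; exact: pres_lt.
  elim: k => [/filter_ex[x]//|k IH Fk].
  have [?|Fc] := in_ultra_setVsetC [set x : Zp | x n = k] UF; first by exists k.
  apply: IH; apply: filterS (filterI Fk Fc) => x [/= + /eqP].
  by rewrite ltnS leq_eqVlt => /orP[->|].
pose a n := sval (res n).
have aP n : F [set x : Zp | x n = a n] by rewrite /a; case: (res n).
have acoh n : (a n.+1 %% p ^ n)%N = a n.
  have Fa : F ([set x : Zp | x n.+1 = a n.+1] `&` [set x : Zp | x n = a n]).
    exact: filterI (aP n.+1) (aP n).
  have [x [/= <- <-]] := filter_ex Fa.
  exact: presP.
exists (PadicInt p_pr acoh); split => // A /padic_nbhsP[n nA].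
by apply: filterS (aP n).
Qed.

End PadicMetric.

Record flow (R : realType) := Flow {
  flow_space : metricType R;
  flow_map : flow_space -> flow_space;
  flow_compact : compact [set: flow_space];
  flow_continuous : continuous flow_map }.

Definition padic_poly_flow (R : realType) (p : nat) (p_pr : prime p)
    (P : {poly padic_int p_pr}) : flow R :=
  @Flow R (padic_int p_pr) (horner P) padic_compact
    (@padic_horner_continuous p p_pr P).

(* topology and norm of the field C; the library declares them for abstract
   fields only *)
HB.instance Definition _ (R : realType) := NormedModule.copy R[i] R[i]^o.

(* e^(i x) *)
Definition cis (R : realType) (x : R) : R[i] := Complex (cos x) (sin x).

(* Sequences are indexed by n >= 1: the value c 0 is never used. *)
Definition oscillating (R : realType) (c : nat -> R[i]) : Prop :=
  forall t : R, 0 <= t < 1 ->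
  (fun N : nat =>
     N%:R^-1 * \sum_(1 <= n < N.+1) c n * cis (- (2 * pi * n%:R * t)))
    @ \oo --> (0 : R[i]).

Definition growth_condition (R : realType) (lambda : R) (c : nat -> R[i]) :
    Prop :=
  (fun N : nat => \sum_(1 <= n < N.+1) (Normc.normc (c n)) `^ lambda)
    =O_\oo (fun N : nat => N%:R : R).

Definition linearly_disjoint (R : realType) (c : nat -> R[i]) (X : flow R) :
    Prop :=
  forall f : flow_space X -> R[i], continuous f ->
  forall x : flow_space X,
  (fun N : nat =>
     N%:R^-1 * \sum_(1 <= n < N.+1) c n * f (iter n (@flow_map R X) x))
    @ \oo --> (0 : R[i]).

(* Main.v *)
Require Import Defs.
From HB Require Import structures.
From mathcomp Require Import all_boot all_order all_algebra.
From mathcomp Require Import all_classical all_reals all_analysis.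
From mathcomp.real_closed Require Import complex.

Set Implicit Arguments.
Unset Strict Implicit.
Unset Printing Implicit Defensive.

Import Order.TTheory GRing.Theory Num.Theory.
Import numFieldNormedType.Exports.

Local Open Scope classical_set_scope.
Local Open Scope ring_scope.

(** Modulo [p ^ n] a polynomial acts on finitely many residues, so the residues
   of an orbit of [P] form an eventually periodic sequence
   ([iter_eventually_periodic], [presX_eq]).  A continuous [f] on the compact
   space Z_p is, up to any [e > 0], a function of the residue modulo some
   [p ^ n] ([padic_unif_continuous]).  Hence [f (P^i x)] is a uniform limit of
   eventually periodic sequences.

   A periodic sequence is a finite combination of exponentials
   [exp (- 2 pi i n j / q)] ([periodic_fourier]), so its means weighted by an
   oscillating sequence [c] tend to 0; the preperiod contributes a bounded sum,
   which division by [N] kills ([oscillating_eventually_periodic]).  The growth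
   condition keeps the means of [|c n|] bounded ([growth_mean_bounded]), and so
   a uniform error [e] in the test sequence changes the weighted means by
   [O(e)] only ([mean_null_unif_approx]). *)

(** * Null weighted means *)

Section WeightedMeans.
Context {R : realType}.
Implicit Types (c u v : nat -> R[i]) (e : R).

Lemma complex_normE (z : R[i]) : `|z| = (Normc.normc z)%:C%C.
Proof. by case: z. Qed.

(** Convergence in the normed space [R[i]] is tested by an epsilon in [R[i]]
   itself; a positive complex number is real, so a real epsilon suffices. *)
Lemma cvg0_normcP u :
  (u @ \oo --> (0 : R[i])) <->
  (forall e, 0 < e -> \forall N \near \oo, Normc.normc (u N) <= e).
Proof.
split=> [/cvgr0Pnorm_le u0 e e0|u0].
  have /u0 : 0 < (e%:C)%C :> R[i] by rewrite ltcR.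
  by apply: filterS => N; rewrite complex_normE lecR.
apply/cvgr0Pnorm_le => -[a b]; rewrite ltcE /= => /andP[/eqP -> a0].
by apply: filterS (u0 _ a0) => N; rewrite complex_normE lecR.
Qed.

Definition mean c u N : R[i] := N%:R^-1 * \sum_(1 <= n < N.+1) c n * u n.

Definition mean_null c u := mean c u @ \oo --> (0 : R[i]).

Lemma eq_mean_null c u v : u =1 v -> mean_null c u -> mean_null c v.
Proof. by move=> /funext ->. Qed.

Lemma meanD c u v N : mean c (fun n => u n + v n) N = mean c u N + mean c v N.
Proof.
by rewrite /mean -mulrDr -big_split/=; under eq_bigr do rewrite mulrDr.
Qed.

Lemma meanZ c (a : R[i]) u N : mean c (fun n => a * u n) N = a * mean c u N.
Proof.
by rewrite /mean mulrCA [a * _]mulr_sumr; under eq_bigr do rewrite mulrCA.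
Qed.

Lemma mean_nullD c u v :
  mean_null c u -> mean_null c v -> mean_null c (fun n => u n + v n).
Proof.
move=> cu cv; rewrite /mean_null (funext (meanD c u v)) -[0](addr0 0).
exact: cvgD.
Qed.

Lemma mean_nullZ c (a : R[i]) u :
  mean_null c u -> mean_null c (fun n => a * u n).
Proof.
move=> cu; rewrite /mean_null (funext (meanZ c a u)) -[0](mulr0 a).
exact: (@cvgMl_tmp R[i]).
Qed.

Lemma mean_null_sum c q (u : nat -> nat -> R[i]) :
  (forall j, (j < q)%N -> mean_null c (u j)) ->
  mean_null c (fun n => \sum_(j < q) u j n).
Proof.
elim: q => [|q IH] cu.
  apply: (@eq_mean_null _ (fun=> 0 * 0)) => [n|].
    by rewrite big_ord0 mul0r.
  rewrite /mean_null (funext (meanZ c 0 (fun=> 0))).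
  under [X in X @ _]funext do rewrite mul0r.
  exact: cvg_cst.
apply: (@eq_mean_null _ (fun n => \sum_(j < q) u j n + u q n)) => [n|].
  by rewrite big_ord_recr.
by apply: mean_nullD; [apply: IH => j /ltnW; exact: cu|exact: cu].
Qed.

Lemma normc_natr n : Normc.normc (n%:R : R[i]) = n%:R.
Proof.
apply: complexI; rewrite -complex_normE normr_nat.
by rewrite -(rmorph_nat (real_complex R)).
Qed.

(** The sums for [u] and [v] differ by a quantity that is constant once [N]
   reaches [k], and division by [N] sends it to 0. *)
Lemma mean_null_tail c u v k :
  (forall n, (k <= n)%N -> u n = v n) -> mean_null c v -> mean_null c u.
Proof.
move=> uv cv.
suff cuv : mean_null c (fun n => u n - v n).
  by apply: eq_mean_null (mean_nullD cuv cv) => n; rewrite subrK.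
pose S := \sum_(1 <= n < k.+1) c n * (u n - v n).
have tail N : (k <= N)%N -> \sum_(1 <= n < N.+1) c n * (u n - v n) = S.
  move=> kN; rewrite (big_cat_nat _ (n := k.+1))//= -/S.
  rewrite [X in _ + X]big_nat [X in _ + X]big1 ?addr0// => n /andP[kn _].
  by rewrite uv ?subrr ?mulr0// ltnW.
apply/cvg0_normcP => e e0; near=> N.
have kN : (k <= N)%N by near: N; exact: nbhs_infty_ge.
rewrite /mean tail// Normc.normcM Normc.normcV normc_natr.
have N0 : 0 < N%:R :> R by rewrite ltr0n; near: N; exact: nbhs_infty_gt.
rewrite mulrC ler_pdivrMr// -ler_pdivrMl//.
near: N; exact: nbhs_infty_ger.
Unshelve. all: by end_near. Qed.

Lemma normc_ge0 (z : R[i]) : 0 <= Normc.normc z.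
Proof. by case: z => a b; exact: sqrtr_ge0. Qed.

Lemma ler_normc_sum (u : nat -> R[i]) m n :
  Normc.normc (\sum_(m <= k < n) u k) <= \sum_(m <= k < n) Normc.normc (u k).
Proof.
have := ler_norm_sum (index_iota m n) u xpredT.
rewrite complex_normE; under [leRHS]eq_bigr do rewrite complex_normE.
by rewrite -rmorph_sum lecR.
Qed.

Lemma le_1DpowR (a lambda : R) : 0 <= a -> 1 <= lambda -> a <= 1 + a `^ lambda.
Proof.
move=> a0 l1; have [a1|/ltW a1] := leP a 1.
  by rewrite (le_trans a1)// lerDl powR_ge0.
by rewrite (le_trans _ (ler_wpDl ler01 (ler_powR a1 l1)))// powRr1.
Qed.

(** As only boundedness matters, summing the pointwise bound
   [a <= 1 + a `^ lambda] replaces Hoelder's inequality. *)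
Lemma growth_mean_bounded c (lambda : R) :
  1 <= lambda -> growth_condition lambda c ->
  exists2 K : R, 0 < K &
    \forall N \near \oo, \sum_(1 <= n < N.+1) Normc.normc (c n) <= K * N%:R.
Proof.
move=> l1 /eqO_exP[K K0 cK]; exists (1 + K); first exact: addr_gt0.
apply: filterS cK => N; rewrite /= [`|N%:R|]ger0_norm// => cK.
rewrite mulrDl mul1r.
apply: (@le_trans _ _ (\sum_(1 <= n < N.+1) (1 + Normc.normc (c n) `^ lambda))).
  by apply: ler_sum => n _; exact: le_1DpowR (normc_ge0 _) l1.
rewrite big_split/= sumr_const_nat subn1 lerD2l.
exact: le_trans (ler_norm _) cK.
Qed.

(** The sequences whose weighted means vanish are closed under uniform limits:
   an error [e] costs at most [e] times the mean of [|c n|]. *)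
Lemma mean_null_unif_approx c (lambda : R) u :
  1 <= lambda -> growth_condition lambda c ->
  (forall e, 0 < e -> exists2 v, mean_null c v &
     forall n, Normc.normc (u n - v n) <= e) ->
  mean_null c u.
Proof.
move=> l1 /(growth_mean_bounded l1)[K K0 cK] uv; apply/cvg0_normcP => e e0.
have [v cv uve] : exists2 v, mean_null c v &
    forall n, Normc.normc (u n - v n) <= e / 2 / K.
  by apply: uv; rewrite !divr_gt0.
have /cvg0_normcP/(_ (e / 2)) := cv; rewrite divr_gt0// => /(_ isT) cve.
near=> N.
have N0 : 0 < N%:R :> R by rewrite ltr0n; near: N; exact: nbhs_infty_gt.
have -> : mean c u N = mean c v N + mean c (fun n => u n - v n) N.
  by rewrite -meanD; congr mean; apply/funext => n; rewrite addrC subrK.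
apply: (le_trans (le_normcD _ _)); rewrite [leRHS]splitr lerD//.
  by near: N; exact: cve.
rewrite /mean Normc.normcM Normc.normcV normc_natr mulrC ler_pdivrMr//.
apply: (le_trans (ler_normc_sum _ _ _)).
apply: (@le_trans _ _ (\sum_(1 <= n < N.+1) Normc.normc (c n) * (e / 2 / K))).
  by apply: ler_sum => n _; rewrite Normc.normcM ler_wpM2l// normc_ge0.
rewrite -mulr_suml mulrC -ler_pdivlMl ?divr_gt0//.
rewrite (le_trans (_ : _ <= K * N%:R))//.
  by near: N; exact: cK.
by rewrite invf_div mulrA divfK// gt_eqF// divr_gt0.
Unshelve. all: by end_near. Qed.

End WeightedMeans.

(** * Oscillation against periodic sequences *)

Section PeriodicSequences.
Context {R : realType}.
Implicit Types (c u v : nat -> R[i]) (x y : R).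

Lemma cisD x y : cis (x + y) = cis x * cis y.
Proof. by rewrite /cis cosD sinD; simpc; rewrite [sin x * _ + _]addrC. Qed.

Lemma cisMn x n : cis (x *+ n) = cis x ^+ n.
Proof.
elim: n => [|n IH]; first by rewrite mulr0n expr0 /cis cos0 sin0.
by rewrite mulrS exprS cisD IH.
Qed.

Lemma cis_2piN : cis (- (2 * pi) : R) = 1.
Proof.
rewrite /cis cosN sinN mulrC mulr_natr cos2pi.
by rewrite sin_mulr2n sinpi mulr0 mul0rn oppr0.
Qed.

(** [1 - cos x = 2 sin (x / 2) ^ 2], and [sin] is positive on the open
   half-period. *)
Lemma cis_neq1 x : 0 < x < 2 * pi -> cis (- x) != 1.
Proof.
move=> /andP[x0 x2pi]; apply/eqP => -[cosx1 _].
have : 0 < sin (x / 2).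
  by apply: sin_gt0_pi; rewrite divr_gt0//= ltr_pdivrMr// mulrC.
move: cosx1; rewrite cosN [x in cos x]splitr -mulr2n cos_mulr2n cos2sin2.
rewrite mulrnBl [1 *+ 2]mulr2n -addrA [_ - 1]addrC addrA addrK => /eqP.
rewrite -subr_eq0 addrAC subrr add0r oppr_eq0 mulrn_eq0 /= sqrf_eq0.
by move=> /eqP ->; rewrite ltxx.
Qed.

(** The sign is that of the exponentials in [oscillating], so that the
   sequences of powers of [z ^+ j], for this root [z], are those at the
   frequencies [j / q]. *)
Lemma cis_prim_root q :
  (0 < q)%N -> q.-primitive_root (cis (- (2 * pi / q%:R)) : R[i]).
Proof.
move=> q0; have q0R : 0 < q%:R :> R by rewrite ltr0n.
have zX j : cis (- (2 * pi / q%:R)) ^+ j = cis (- (2 * pi / q%:R *+ j)) :> R[i].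
  by rewrite -cisMn mulNrn.
rewrite /primitive_root_of_unity q0 /=.
apply/forallP => -[i iq] /=; rewrite unity_rootE zX.
have [->|iNq] := eqVneq i.+1 q.
  by rewrite -[_ / _ *+ q]mulr_natr (divfK (lt0r_neq0 q0R)) cis_2piN eqxx.
have {iNq}iq : (i.+1 < q)%N by rewrite ltn_neqAle iNq.
rewrite (negbTE (cis_neq1 _))//.
rewrite pmulrn_lgt0// divr_gt0 ?mulr_gt0 ?pi_gt0//=.
rewrite -mulr_natr mulrAC ltr_pdivrMr// ltr_pM2l ?ltr_nat//.
by rewrite mulr_gt0 ?pi_gt0.
Qed.

(** Orthogonality of the characters of Z/q: unless [k] and [a] are congruent,
   [w := z ^+ k / z ^+ a] is a [q]-th root of unity other than 1, and [w - 1]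
   times the geometric sum is [w ^+ q - 1 = 0]. *)
Lemma sum_prim_root_expr (F : fieldType) (z : F) q a k :
  q.-primitive_root z ->
  \sum_(j < q) (z ^+ k / z ^+ a) ^+ j = q%:R *+ (k == a %[mod q]).
Proof.
move=> zq; have z0 : z != 0.
  apply/eqP => z0; have /eqP := prim_expr_order zq.
  by rewrite z0 expr0n gtn_eqF ?(prim_order_gt0 zq)// eq_sym oner_eq0.
have [ka|kNa] := boolP (k == a %[mod q]).
  move: ka; rewrite -(eq_prim_root_expr zq) => /eqP ->.
  rewrite divff ?expf_neq0//; under eq_bigr do rewrite expr1n.
  by rewrite sumr_const card_ord.
set w := _ / _; have w1 : w - 1 != 0.
  rewrite subr_eq0; apply: contra kNa => /eqP wE.
  rewrite -(eq_prim_root_expr zq) -[z ^+ k](divfK (expf_neq0 a z0)).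
  by rewrite -/w wE mul1r.
apply: (mulfI w1); rewrite mulr0 -subrX1 /w exprMn exprVn -!exprM.
rewrite ![(_ * q)%N]mulnC !exprM (prim_expr_order zq).
by rewrite !expr1n invr1 mulr1 subrr.
Qed.

(** Discrete Fourier inversion: [h j] is the coefficient of [u] on the [j]-th
   character of Z/q, and orthogonality recovers [u]. *)
Lemma periodic_fourier (F : numFieldType) (z : F) q (u : nat -> F) :
  q.-primitive_root z -> (forall n, u (n + q)%N = u n) ->
  exists h : nat -> F, forall n, u n = \sum_(j < q) h j * (z ^+ j) ^+ n.
Proof.
move=> zq uq; have q0 := prim_order_gt0 zq.
have umod n : u n = u (n %% q)%N.
  rewrite {1}(divn_eq n q) addnC; elim: (n %/ q)%N => [|d IH].
    by rewrite addn0.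
  by rewrite mulSn addnCA addnC uq.
exists (fun j => q%:R^-1 * \sum_(a < q) u a / (z ^+ a) ^+ j) => n.
transitivity (q%:R^-1 * \sum_(a < q) u a * \sum_(j < q) (z ^+ n / z ^+ a) ^+ j).
  have nq : (n %% q < q)%N by rewrite ltn_pmod.
  rewrite (bigD1 (Ordinal nq))//= [X in _ + X]big1 ?addr0 => [|a aN].
    rewrite (sum_prim_root_expr _ _ zq) modn_mod eqxx mulr1n mulrCA -umod.
    by rewrite mulVf ?mulr1// pnatr_eq0 -lt0n.
  rewrite (sum_prim_root_expr _ _ zq) (modn_small (ltn_ord a)) eq_sym.
  by rewrite -[_ == _]/(a == Ordinal nq) (negbTE aN) mulr0.
rewrite mulr_sumr; under eq_bigr do rewrite mulr_sumr mulr_sumr.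
rewrite exchange_big/=; apply: eq_bigr => j _.
rewrite mulr_sumr mulr_suml; apply: eq_bigr => a _.
rewrite exprMn exprVn -!mulrA -[z ^+ n ^+ j]exprM mulnC exprM.
by rewrite [_^-1 * _ ^+ n]mulrC.
Qed.

Lemma oscillating_periodic c u q :
  oscillating c -> (0 < q)%N -> (forall n, u (n + q)%N = u n) -> mean_null c u.
Proof.
move=> c_osc q0 uq.
have [h uE] := periodic_fourier (cis_prim_root q0) uq.
apply: (eq_mean_null (fun n => esym (uE n))).
apply: (@mean_null_sum _ _ _
  (fun j n => h j * (cis (- (2 * pi / q%:R)) ^+ j) ^+ n)) => j jq.
apply: mean_nullZ; have q0R : 0 < q%:R :> R by rewrite ltr0n.
have /c_osc : 0 <= (j%:R / q%:R : R) < 1.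
  by rewrite divr_ge0//= ltr_pdivrMr// mul1r ltr_nat.
apply: eq_mean_null => n; rewrite -!cisMn !mulNrn.
rewrite -[_ * _ *+ j]mulr_natr -[_ * _ *+ n]mulr_natr.
by congr (cis (- _)); rewrite mulrAC [j%:R / _]mulrC mulrA.
Qed.

(** [n |-> u (n + k * q)] is periodic from the start, because [k <= k * q], and
   agrees with [u] from [k] on, the shift being a multiple of the period. *)
Lemma oscillating_eventually_periodic c u k q :
  oscillating c -> (0 < q)%N ->
  (forall n, (k <= n)%N -> u (n + q)%N = u n) -> mean_null c u.
Proof.
move=> c_osc q0 uq; pose v n := u (n + k * q)%N.
have uv n : (k <= n)%N -> u n = v n.
  rewrite /v => kn; elim: {1}k => [|d IH]; first by rewrite addn0.
  by rewrite mulSn [(q + _)%N]addnC addnA uq// (leq_trans kn)// leq_addr.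
apply: (mean_null_tail uv); apply: (oscillating_periodic c_osc q0) => n.
rewrite /v addnAC uq//; case: q q0 {uq uv v} => // q _.
by rewrite mulnS addnCA leq_addr.
Qed.

End PeriodicSequences.

(** * Orbits and continuous functions modulo powers of p *)

Section PadicOrbits.
Context {p : nat} {p_pr : prime p}.
Local Notation Zp := (padic_int p_pr).

(** By the pigeonhole principle the label [s] takes the same value at two times;
   as it determines the next label, it repeats from then on. *)
Lemma iter_eventually_periodic (T : Type) (f : T -> T) (m : nat)
    (s : T -> nat) (x : T) :
  (forall y, (s y < m)%N) -> (forall y z, s y = s z -> s (f y) = s (f z)) ->
  exists k q, (0 < q)%N /\
    forall n, (k <= n)%N -> s (iter (n + q) f x) = s (iter n f x).
Proof.
move=> s_lt s_f.
pose g (i : 'I_m.+1) : 'I_m := Ordinal (s_lt (iter i f x)).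
have /injectivePn[i [j ij gij]] : ~~ injectiveb g.
  by apply/injectiveP => /leq_card; rewrite !card_ord ltnn.
wlog ltij : i j ij gij / (i < j)%N => [H|].
  have := ij; rewrite -val_eqE neq_ltn => /orP[|]; first exact: H.
  by apply: H; rewrite // eq_sym.
exists i, (j - i)%N; rewrite subn_gt0; split=> // n le_in.
rewrite -(subnK le_in) -addnA subnKC ?(ltnW ltij)// !iterD.
elim: (n - i)%N => [|d IH]; first by have /(congr1 val) := gij.
exact: s_f.
Qed.

(** Uniform continuity on Z_p, with the uniformity spelled out by residues.
   The compactness used is the near-covering property along [n --> oo]: a
   modulus [n] that works near each point works everywhere. *)
Lemma padic_unif_continuous (R : realType) (f : Zp -> R[i]) :
  continuous f -> forall e : R, 0 < e ->
  exists n, forall x y : Zp, x n = y n -> Normc.normc (f x - f y) <= e.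
Proof.
move=> f_cont e e0.
have /compact_near_coveringP cov : compact [set: Zp] by exact: padic_compact.
have e20 : 0 < ((e / 2)%:C)%C :> R[i] by rewrite ltcR divr_gt0.
have [|n _ H] := cov nat \oo
    (fun n x => forall y : Zp, x n = y n -> Normc.normc (f x - f y) <= e) _.
  move=> x _.
  have /cvgr_dist_le/(_ _ e20)/padic_nbhsP[m fm] := f_cont x.
  exists ([set y : Zp | y m = x m], [set n | (m <= n)%N]); first split.
  - by apply/padic_nbhsP; exists m.
  - exact: nbhs_infty_ge.
  move=> [y n] [/= ym mn] z yz.
  have zm : z m = x m by rewrite (pres_le z mn) -yz -(pres_le y mn).
  have := fm _ ym; have := fm _ zm; rewrite /= !complex_normE !lecR => fz fy.
  rewrite -(subrK (f x) (f y)) -addrA (le_trans (le_normcD _ _))//.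
  rewrite [leRHS]splitr lerD//.
  by rewrite -normcN opprB.
by exists n => x y; apply: H => /=.
Qed.

End PadicOrbits.

Theorem corollary4 (R : realType) (p : nat) (p_pr : prime p)
    (c : nat -> R[i]) (c_osc : oscillating c)
    (lambda : R) (lambda_gt1 : 1 < lambda)
    (c_growth : growth_condition lambda c)
    (P : {poly padic_int p_pr}) :
  linearly_disjoint c (padic_poly_flow R P).
Proof.
move=> f f_cont x.
apply: (mean_null_unif_approx (ltW lambda_gt1) c_growth) => e e0.
have [n fn] := padic_unif_continuous f_cont e0.
have [k [q [q0 kq]]] := iter_eventually_periodic x
  (fun y => pres_lt y n) (fun y z => @presX_eq _ _ P y z n).
(* [padic_const a] serves as the representative of the residue class of [a]
   modulo [p ^ n]. *)
exists (fun i => f (padic_const (iter i (horner P) x n))) => [|i]; last first.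
  by apply: fn; rewrite /= pres_mod.
apply: (oscillating_eventually_periodic c_osc q0 (k := k)) => i ki.
by rewrite kq.
Qed.
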